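(* For all $k\in\mathbb{N}$ there exists an oriented graph $D$ with $\operatorname{inv}(D)=2\tau(D)=2k$.
   Context: All digraphs are oriented graphs: directed graphs without loops, digons or parallel edges. For a digraph $D$ and $X\subseteq V(D)$, inverting $X$ in $D$ means reversing the direction of every edge with both endpoints in $X$. A family $X_1,\dots,X_k\subseteq V(D)$ is a decycling family of $D$ if inverting $X_1,\dots,X_k$ in turn yields an acyclic digraph; $\operatorname{inv}(D)$ is the minimum size of a decycling family. A cycle transversal of $D$ is a set of vertices whose removal leaves an acyclic digraph, and $\tau(D)$ is the minimum size of a cycle transversal of $D$. *)

(* Defs.v *)
From mathcomp Require Import all_boot.
From mathcomp Require Import boolp.

Set Implicit Arguments.
Unset Strict Implicit.
Unset Printing Implicit Defensive.

(* [rel T] excludes parallel edges; [edge_asym] excludes digons. *)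
Record oriented_graph (T : finType) := OrientedGraph {
  edge :> rel T;
  edge_irr : irreflexive edge;
  edge_asym : forall x y, edge x y -> ~~ edge y x
}.

Section OrientedGraph.
Variable T : finType.
Implicit Types (D : oriented_graph T) (X : {set T}) (F : seq {set T}).

(* [ucycle] counts the empty sequence as a cycle. *)
Definition acyclic D : Prop := forall c : seq T, ucycle D c -> c = [::].

Definition invert_rel D X : rel T :=
  fun x y => if (x \in X) && (y \in X) then D y x else D x y.

Lemma invert_irr D X : irreflexive (invert_rel D X).
Proof. by move=> x; rewrite /invert_rel if_same edge_irr. Qed.

Lemma invert_asym D X x y : invert_rel D X x y -> ~~ invert_rel D X y x.
Proof. by rewrite /invert_rel [(y \in X) && _]andbC; case: ifP => _ /edge_asym. Qed.

Definition invert D X : oriented_graph T :=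
  OrientedGraph (@invert_irr D X) (@invert_asym D X).

Definition invert_family D F : oriented_graph T := foldl invert D F.

Definition decycling_family D F : Prop := acyclic (invert_family D F).

Lemma invert_familyE D F x y :
  invert_family D F x y =
  if odd (count (fun X : {set T} => (x \in X) && (y \in X)) F)
  then D y x else D x y.
Proof.
rewrite /invert_family; elim: F D => [|X F IHF] D //=.
rewrite IHF /= /invert_rel oddD [(y \in X) && _]andbC.
by case: ((x \in X) && (y \in X)); case: (odd _).
Qed.

Lemma acyclic_homo (f : T -> nat) D :
  (forall x y, D x y -> f x < f y) -> acyclic D.
Proof.
move=> Df [|x p] //= /andP[/=]; rewrite rcons_path => /andP[Dp Dx] _.
suff: f x < f x by rewrite ltnn.
apply: leq_ltn_trans (Df _ _ Dx).
elim: p x Dp {Dx} => [|y p IHp] x //= /andP[/Df/ltnW xy /IHp].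
exact: leq_trans.
Qed.

Lemma decycling_family_exists D :
  exists n, `[< exists F, size F = n /\ decycling_family D F >].
Proof.
pose back := [pred u : T * T | D u.1 u.2 && (enum_rank u.2 < enum_rank u.1)].
pose F := [seq [set u.1; u.2] | u <- enum back].
exists (size F); apply/asboolP; exists F; split=> //.
apply: (@acyclic_homo (fun x => enum_rank x)) => x y.
rewrite invert_familyE.
have neq a b : D a b -> a != b by apply: contraTneq => ->; rewrite edge_irr.
have cnt a b : D a b ->
    count (fun X : {set T} => (a \in X) && (b \in X)) F = back (a, b).
  move=> Dab; rewrite count_map.
  have -> : back (a, b) = ((a, b) \in enum back) by rewrite mem_enum.
  rewrite -(count_uniq_mem _ (enum_uniq _)).
  apply: eq_in_count => -[u v]; rewrite mem_enum inE /= => /andP[Duv _].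
  rewrite /= !inE xpair_eqE.
  have nab := neq _ _ Dab; have ba := edge_asym Dab.
  apply/idP/andP=> [/andP[/orP[]/eqP ea /orP[]/eqP eb] | [/eqP-> /eqP->]].
  - by rewrite ea eb eqxx in nab.
  - by rewrite ea eb !eqxx.
  - by rewrite ea eb Duv in ba.
  - by rewrite ea eb eqxx in nab.
  - by rewrite !eqxx orbT.
have [Dxy | nDxy] := boolP (D x y).
  rewrite (cnt _ _ Dxy) /= Dxy (negbTE (edge_asym Dxy)) /=.
  case: ltnP => //= le_xy _; rewrite ltn_neqAle le_xy andbT.
  by rewrite val_eqE (inj_eq enum_rank_inj) neq.
case: ifP => // + Dyx; under eq_count do rewrite andbC.
by rewrite cnt //= Dyx /=; case: ltnP.
Qed.

Definition inversion_number D : nat := ex_minn (decycling_family_exists D).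

Definition remove_rel D X : rel {x : T | x \notin X} :=
  fun x y => D (val x) (val y).

Lemma remove_irr D X : irreflexive (@remove_rel D X).
Proof. by move=> x; apply: edge_irr. Qed.

Lemma remove_asym D X x y : @remove_rel D X x y -> ~~ @remove_rel D X y x.
Proof. exact: edge_asym. Qed.

Definition remove_vertices D X : oriented_graph {x : T | x \notin X} :=
  OrientedGraph (@remove_irr D X) (@remove_asym D X).

End OrientedGraph.

Definition cycle_transversal (T : finType) (D : oriented_graph T)
  (X : {set T}) : Prop := acyclic (remove_vertices D X).

Lemma cycle_transversal_exists (T : finType) (D : oriented_graph T) :
  exists n, `[< exists X : {set T}, #|X| = n /\ cycle_transversal D X >].
Proof.
exists #|T|; apply/asboolP; exists [set: T]; split; first exact: cardsT.
by case=> [|x c] //; have := valP x; rewrite inE.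
Qed.

Definition transversal_number (T : finType) (D : oriented_graph T) : nat :=
  ex_minn (cycle_transversal_exists D).

(* Main.v *)
(** A family of [m] inversions gives every vertex an indicator vector in
    [F_2^m], and reverses exactly the edges whose end vectors have dot product
    [1].  Take vertices [x_1, ..., x_k] and many consecutive blocks of [k + 1]
    vertices [v_p], where [p] is [None] or [Some i]; edges between blocks go
    forward, and [x_i] points to the vertices of type [Some i] and receives an
    edge from all others.  If the result of the inversions is acyclic, choose
    three blocks carrying the same vectors [u_p].  Looking at short cycles, the
    products [u_p . u_q] are all equal, and inside these blocks each [x_i]
    becomes a source or a sink.  Hence the [u_(Some i) - u_None] span a totally
    isotropic space which is dual to the vectors of the [x_i], so it has
    dimension [k] and [2 k <= m].  The rest follows from
    [inv D <= 2 tau D] and [tau D <= k]. *)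

Require Import Defs.
From mathcomp Require Import all_boot all_algebra.
From mathcomp Require Import boolp zify.

Set Implicit Arguments.
Unset Strict Implicit.
Unset Printing Implicit Defensive.

Import GRing.Theory.

(** The number of vertices from which [x] can be reached grows along an edge from [x] to [y]: [y]
    itself is new, since a path from [y] to [x] would close a cycle. *)
Lemma acyclic_potential (T : finType) (D : oriented_graph T) :
  acyclic D -> exists f : T -> nat, forall x y, D x y -> f x < f y.
Proof.
move=> acD; exists (fun x => #|[pred y | connect D y x]|) => x y Dxy.
apply/proper_card/properP; split.
  by apply/subsetP=> z; rewrite !inE => zx; apply: connect_trans zx (connect1 Dxy).
exists y; rewrite !inE ?connect0 //; apply/negP=> /connectP[p Dp lastp].
case/shortenP: Dp lastp => p' Dp' up' _ lastp.
have /acD : ucycle D (y :: p') by rewrite /ucycle /= rcons_path Dp' -lastp Dxy.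
by [].
Qed.

Lemma inversion_number_min (T : finType) (D : oriented_graph T) F :
  decycling_family D F -> inversion_number D <= size F.
Proof.
move=> decF; rewrite /inversion_number; case: ex_minnP => m _; apply.
by apply/asboolP; exists F.
Qed.

Lemma transversal_number_min (T : finType) (D : oriented_graph T) X :
  cycle_transversal D X -> transversal_number D <= #|X|.
Proof.
move=> tX; rewrite /transversal_number; case: ex_minnP => m _; apply.
by apply/asboolP; exists X.
Qed.

Lemma odd_count_addb (T : Type) (P Q : pred T) s :
  odd (count P s) (+) odd (count Q s) = odd (count (fun z => P z (+) Q z) s).
Proof.
by elim: s => //= z s IHs; rewrite !oddD -IHs !oddb addbACA.
Qed.

Lemma odd_count_pred1 (T : eqType) (a : T) (b : bool) s : uniq s ->
  odd (count (fun z => (z == a) && b) s) = (a \in s) && b.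
Proof.
case: b => us; last by under eq_count do rewrite andbF; rewrite count_pred0 andbF.
by under eq_count do rewrite andbT; rewrite andbT count_uniq_mem // oddb.
Qed.

(* For each vertex [x] of a transversal [X], inverting [S x] and then
   [x |: S x] reverses precisely the edges from [x] to [S x]. Afterwards all
   edges between [X] and its complement enter [X], and edges inside [X] go down
   in the enumeration. *)
Lemma inversion_number_le_transversal (T : finType) (D : oriented_graph T) :
  inversion_number D <= 2 * transversal_number D.
Proof.
rewrite /transversal_number; case: ex_minnP => _ /asboolP[X [<- acX]] _.
have [f fP] := acyclic_potential acX.
pose idx (x : T) : nat := enum_rank x.
pose S x := [set y | D x y && ((y \in X) ==> (idx x < idx y))].
pose F := [seq S x | x <- enum X] ++ [seq x |: S x | x <- enum X].
have <- : size F = 2 * #|X| by rewrite size_cat !size_map -cardE mul2n addnn.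
apply: inversion_number_min.
have flip a b : a != b ->
    odd (count (fun Z : {set T} => (a \in Z) && (b \in Z)) F)
  = (a \in X) && (b \in S a) (+) (b \in X) && (a \in S b).
  move=> nab; rewrite count_cat !count_map oddD odd_count_addb.
  rewrite -(mem_enum X a) -(mem_enum X b) -!odd_count_pred1 ?enum_uniq //.
  rewrite odd_count_addb; congr odd; apply: eq_count => z /=.
  rewrite !(inE, eq_sym z).
  have [<-|naz] := eqVneq a z.
    by rewrite (eq_sym b) (negbTE nab) edge_irr /= addbF.
  have [<-|nbz] := eqVneq b z; last by rewrite /= addbb.
  by rewrite edge_irr /= !andbF andbT.
(* Vertices of [X] are placed above all values of [f], in reverse order of [idx]. *)
pose M := \max_(u : {x : T | x \notin X}) f u.
pose g x := if insub x is Some u then f u else M.+1 + (#|T| - idx x).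
have g_sink x y : y \in X -> (x \in X) ==> (idx y < idx x) -> g x < g y.
  rewrite /g => yX; rewrite [insub y]insubF ?yX //.
  case: insubP => [u /negbTE-> _ _|]; last first.
    rewrite negbK => -> /= ltyx; rewrite ltn_add2l ltn_sub2l //.
    exact: ltn_ord.
  by rewrite addSn ltnS (leq_trans _ (leq_addr _ _)) // /M leq_bigmax.
have g_rest x y : x \notin X -> y \notin X -> D x y -> g x < g y.
  by move=> xX yX Dxy; rewrite /g !insubT; apply: fP.
have neq a b : D a b -> a != b by apply: contraTneq => ->; rewrite edge_irr.
apply: (@acyclic_homo _ g) => x y; rewrite invert_familyE.
have [Dxy | nDxy] := boolP (D x y).
  have nDyx := negbTE (edge_asym Dxy).
  rewrite flip ?neq // !inE Dxy nDyx /= andbF addbF.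
  case: ifP => // nx _; case: (boolP (y \in X)) nx => [yX | yX] /=.
    case: (boolP (x \in X)) => [xX /= le | xX _]; apply: g_sink => //.
      rewrite xX /= ltn_neqAle leqNgt le andbT.
      by rewrite val_eqE (inj_eq enum_rank_inj) eq_sym neq.
    by rewrite (negbTE xX).
  by rewrite andbT => xX; apply: g_rest; rewrite ?xX.
case: ifP => // + Dyx; rewrite flip 1?eq_sym ?neq // !inE (negbTE nDxy) Dyx.
by rewrite /= andbF => /andP[]; apply: g_sink.
Qed.

(** The first identity gives [W] rank [k]; the second puts its row space inside the orthogonal
    complement of that space, so twice the rank is at most [m]. *)
Lemma isotropic_pairing_dim (K : fieldType) k m (A W : 'M[K]_(k, m)) :
  (A *m W^T = 1%:M)%R -> (W *m W^T = 0)%R -> 2 * k <= m.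
Proof.
move=> AW WW; have rW : \rank W = k.
  apply/eqP; rewrite eqn_leq rank_leq_row /= -mxrank_tr.
  by rewrite -{1}(mxrank1 K k) -AW mxrankM_maxr.
by have := mulmx0_rank_max WW; rewrite mxrank_tr rW mul2n addnn.
Qed.

Lemma pigeonhole3 (C : finType) n (c : 'I_n -> C) :
    2 * #|C| < n ->
  exists t : 'I_3 -> 'I_n, {homo t : i j / i < j} /\ forall i j, c (t i) = c (t j).
Proof.
move=> ltCn.
have [a] : exists a, 2 < #|[set t | c t == a]|.
  apply: contraPP ltCn => /forallNP small.
  apply/negP; rewrite -leqNgt -{1}(card_ord n) -sum1_card.
  rewrite (partition_big c xpredT) //= mulnC -sum_nat_const.
  apply: leq_sum => a _; have /negP := small a; rewrite -leqNgt.
  by rewrite sum1_card cardsE.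
rewrite cardE; set s := enum _ => lt2s.
(* [enum] lists ordinals increasingly, so the first three entries of [s] can serve as [t]. *)
have ss : sorted (fun i j : 'I_n => i < j) s.
  rewrite /s /enum_mem -enumT; apply: sorted_filter.
    by move=> y x z; apply: ltn_trans.
  by have := iota_ltn_sorted 0 n; rewrite -val_enum_ord sorted_map enumT.
have t0 : 'I_n by case: s lt2s {ss} => [|t].
have t_in (i : 'I_3) : i < size s by apply: leq_trans lt2s.
have cE i : c (nth t0 s (i : 'I_3)) = a.
  by have := mem_nth t0 (t_in i); rewrite mem_enum inE => /eqP.
exists (fun i : 'I_3 => nth t0 s i); split=> [i j ij|i j]; last by rewrite !cE.
apply: (@sorted_ltn_nth _ _ _ t0 s ss i j) => //; rewrite ?inE //.
by move=> y x z; apply: ltn_trans.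
Qed.

Definition indicator_row (T : finType) (F : seq {set T}) (x : T)
  : 'rV['F_2]_(size F) := (\row_j (x \in nth set0 F j)%:R)%R.

Definition dotmx (K : fieldType) m (a b : 'rV[K]_m) : K := ((a *m b^T) 0 0)%R.

Lemma dotmxBl (K : fieldType) m (a b c : 'rV[K]_m) :
  (dotmx (a - b) c = dotmx a c - dotmx b c)%R.
Proof. by rewrite /dotmx mulmxBl !mxE. Qed.

Lemma dotmxBr (K : fieldType) m (a b c : 'rV[K]_m) :
  (dotmx a (b - c) = dotmx a b - dotmx a c)%R.
Proof. by rewrite /dotmx linearB mulmxBr !mxE. Qed.

Lemma mulmx_tr_rowE (K : fieldType) k m (u v : 'I_k -> 'rV[K]_m) i j :
  (((\matrix_i u i) *m (\matrix_i v i)^T) i j = dotmx (u i) (v j))%R.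
Proof. by rewrite /dotmx !mxE; apply: eq_bigr => l _; rewrite !mxE. Qed.

Definition flipped (T : finType) (F : seq {set T}) (x y : T) : bool :=
  odd (count (fun X : {set T} => (x \in X) && (y \in X)) F).

Lemma flippedC (T : finType) (F : seq {set T}) x y :
  flipped F x y = flipped F y x.
Proof. by rewrite /flipped; under eq_count do rewrite andbC. Qed.

Lemma natrF2_odd n : (n%:R = (odd n)%:R :> 'F_2)%R.
Proof. by apply: val_inj; rewrite /= !val_Fp_nat // !modn2 oddb. Qed.

Lemma dotmx_indicator (T : finType) (F : seq {set T}) x y :
  (dotmx (indicator_row F x) (indicator_row F y) = (flipped F x y)%:R)%R.
Proof.
rewrite /flipped -natrF2_odd -sumn_count sumnE big_map (big_nth set0) big_mkord.
rewrite natr_sum /dotmx mxE.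
by apply: eq_bigr => j _; rewrite !mxE -natrM mulnb.
Qed.

Definition block_rel k N : rel ('I_k + 'I_N * option 'I_k) := fun a b =>
  match a, b with
  | inl i, inr (_, p) => p == Some i
  | inr (_, p), inl i => p != Some i
  | inr (s, _), inr (t, _) => s < t
  | inl _, inl _ => false
  end.

Lemma block_irr k N : irreflexive (@block_rel k N).
Proof. by case=> [i|[s p]] //=; rewrite ltnn. Qed.

Lemma block_asym k N x y : @block_rel k N x y -> ~~ block_rel y x.
Proof.
case: x y => [i|[s p]] [j|[t q]] //=; first by rewrite negbK.
by rewrite -leqNgt => /ltnW.
Qed.

Definition block_graph k N := OrientedGraph (@block_irr k N) (@block_asym k N).

Lemma block_transversal_number k N : transversal_number (block_graph k N) <= k.
Proof.
have cX : #|inl @: [set: 'I_k] : {set 'I_k + 'I_N * option 'I_k}| = k.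
  by rewrite card_imset ?cardsT ?card_ord //; apply: inl_inj.
apply: leq_trans (transversal_number_min _) (eq_leq cX).
(* The value [0] on [inl] is a dummy: those vertices are removed. *)
pose pos (x : 'I_k + 'I_N * option 'I_k) := if x is inr (t, _) then t : nat else 0.
apply: (@acyclic_homo _ (fun x => pos (val x))).
move=> [[i|[s p]] /= xX] [[j|[t q]] /= yX] //.
  by rewrite imset_f ?inE in xX.
by rewrite imset_f ?inE in yX.
Qed.

Lemma block_decycling_size k N F :
    2 * #|{ffun option 'I_k -> 'rV['F_2]_(size F)}| < N ->
  decycling_family (block_graph k N) F -> 2 * k <= size F.
Proof.
move=> ltN /acyclic_potential[f fP].
(* The colour of a block is the tuple of vectors of all its vertices, one for each type. *)
pose c s : {ffun option 'I_k -> 'rV['F_2]_(size F)} :=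
  [ffun p => indicator_row F (inr (s, p))].
have [t [t_lt t_c]] := pigeonhole3 c ltN.
pose v j p : 'I_k + 'I_N * option 'I_k := inr (t j, p).
pose u p := indicator_row F (v ord0 p).
have uE j p : indicator_row F (v j p) = u p.
  by have /ffunP/(_ p) := t_c j ord0; rewrite !ffunE.
pose g p q := flipped F (v ord0 p) (v ord0 q).
pose h i p := flipped F (inl i) (v ord0 p).
have natr_inj2 (a b : bool) : (a%:R = b%:R :> 'F_2)%R -> a = b by case: a b => [][].
have gE i j p q : flipped F (v i p) (v j q) = g p q.
  by apply: natr_inj2; rewrite -!dotmx_indicator !uE.
have hE i j p : flipped F (inl i) (v j p) = h i p.
  by apply: natr_inj2; rewrite -!dotmx_indicator !uE.
have vv (i j : 'I_3) p q : i < j ->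
    if g p q then f (v j q) < f (v i p) else f (v i p) < f (v j q).
  move=> /t_lt ltij; case: ifP => gpq; apply: fP.
    by rewrite invert_familyE -/(flipped _ _ _) flippedC gE gpq.
  by rewrite invert_familyE -/(flipped _ _ _) gE gpq.
have xv i j p : if (p == Some i) (+) h i p then f (inl i) < f (v j p)
                else f (v j p) < f (inl i).
  case: ifP => hip; apply: fP; rewrite invert_familyE -/(flipped _ _ _).
    by rewrite hE /=; case: (h i p) hip; rewrite /= ?addbT ?addbF.
  rewrite flippedC hE /=; case: (h i p) hip; rewrite /= ?addbT ?addbF => /negbT //.
  by rewrite negbK.
pose t0 : 'I_3 := ord0; pose t1 : 'I_3 := Ordinal (isT : 1 < 3).
pose t2 : 'I_3 := Ordinal (isT : 2 < 3).
have gC p q : g p q = g q p by apply: flippedC.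
(* If [g p q] differed from [g p p], then [v t0 p], [v t1 q], [v t2 p] would form a directed
   triangle after the inversions. *)
have g_diag p q : g p q = g p p.
  have vvs a b := And3 (vv t0 t1 a b isT) (vv t0 t2 a b isT) (vv t1 t2 a b isT).
  move: (vvs p p) (vvs p q) (vvs q p) (vvs q q); rewrite (gC q).
  by case: (g p p); case: (g p q); case: (g q q) => // -[? ? ?] [? ? ?] [? ? ?] [? ? ?]; lia.
have gN p q : g p q = g None None.
  by rewrite g_diag -(g_diag p None) gC g_diag.
(* Since [g] is constant, edges run both from type [p] to type [None] and back. If [inl i] were a
   source for one type and a sink for the other, one of these edges would close a triangle through
   it. *)
have hN i p : h i p = (p == Some i) (+) h i None.
  apply: (canRL (addKb _)).
  move: (xv i t0 p) (xv i t1 p) (xv i t0 None) (xv i t1 None).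
  move: (vv t0 t1 p None isT) (vv t0 t1 None p isT); rewrite !gN.
  by case: (g _ _); case: (_ (+) h i p); case: (h i None) => //= *; lia.
pose A : 'M['F_2]_(k, size F) := (\matrix_i indicator_row F (inl i))%R.
pose W : 'M['F_2]_(k, size F) := (\matrix_i (u (Some i) - u None))%R.
apply: (@isotropic_pairing_dim _ _ _ A W); apply/matrixP => i j.
  (* By [hN] the entry is [1] or [-1] if [i = j] and [0] otherwise; signs vanish in ['F_2]. *)
  rewrite mulmx_tr_rowE dotmxBr !dotmx_indicator !mxE -!/(h _ _) hN.
  rewrite (inj_eq Some_inj) eq_sym.
  by case: (i == j); case: (h i None); apply: val_inj.
rewrite mulmx_tr_rowE dotmxBl !dotmxBr !dotmx_indicator !mxE -!/(g _ _) !gN.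
by rewrite !subrr.
Qed.

Theorem theorem1p8 (k : nat) :
  exists (T : finType) (D : oriented_graph T),
    inversion_number D = 2 * transversal_number D /\
    2 * transversal_number D = 2 * k.
Proof.
(* Fewer than [2 * k] inversions leave at most [(2 ^ (2 * k)) ^ k.+1] block colours; more than twice
   as many blocks force a colour to occur three times. *)
pose N := (2 * (2 ^ (2 * k)) ^ k.+1).+1.
exists _, (block_graph k N).
have le_inv : 2 * k <= inversion_number (block_graph k N).
  rewrite /inversion_number; case: ex_minnP => _ /asboolP[F [<- decF]] _.
  rewrite leqNgt; apply/negP => ltF; move: (ltF); rewrite ltnNge => /negP; apply.
  apply: block_decycling_size decF.
  rewrite card_ffun card_option card_ord card_mx card_Fp // mul1n ltnS.
  by rewrite leq_mul2l leq_exp2r // leq_exp2l // ltnW.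
have := inversion_number_le_transversal (block_graph k N).
have := block_transversal_number k N.
by split; lia.
Qed.
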